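(* Let $-1<\alpha,\beta<1$ and let $\mu$ be a finite positive Borel measure on $[0,1)$. Then, for any $\theta>0$, the operator $\mathbf{H}_{\mu}:\mathcal{F}^{2}_{\theta,\alpha}\rightarrow\mathcal{F}^{2}_{\theta,\beta}$ is bounded if and only if $\mu$ is a $[1+\frac{1}{2}(\beta-\alpha)]$-Carleson measure on $[0,1)$.
   Context: $\mathcal{H}(\mathbb{C})$ denotes the class of all entire functions on $\mathbb{C}$, and $\mathbb{N}_0=\mathbb{N}\cup\{0\}$. For $\theta>0$ and $\alpha\in\mathbb{R}$, the weighted Fock space is $$\mathcal{F}^{2}_{\theta,\alpha}=\Big\{f=\sum_{n=0}^{\infty}a_nz^n\in\mathcal{H}(\mathbb{C}):\ \|f\|_{\theta,\alpha}^2:=\sum_{n=0}^{\infty}(n+\theta)^{\alpha}|a_n|^2\,n!<\infty\Big\}.$$ It is a Hilbert space with inner product $\langle f,g\rangle=\sum_{n=0}^{\infty}(n+\theta)^{\alpha}a_n\overline{b_n}\,n!$ for $f=\sum a_nz^n$, $g=\sum b_nz^n$. Any power series whose coefficients satisfy the summability condition is automatically entire. For a positive Borel measure $\mu$ on $[0,1)$ put $\mu[n]=\int_{[0,1)}t^{n}\,d\mu(t)$ for $n\in\mathbb{N}_0$. For $f=\sum_{k=0}^{\infty}a_kz^k\in\mathcal{H}(\mathbb{C})$, the Hilbert-type operator $\mathbf{H}_{\mu}$ is defined by $$\mathbf{H}_{\mu}(f)(z):=\sum_{n=0}^{\infty}\left(\frac{1}{\sqrt{n!}}\sum_{k=0}^{\infty}\mu[k+n]\,a_k\sqrt{k!}\right)z^n.$$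 Bounded means that for every $f\in\mathcal{F}^{2}_{\theta,\alpha}$ the coefficient series converge, $\mathbf{H}_\mu(f)\in\mathcal{F}^{2}_{\theta,\beta}$, and there is a constant $C>0$ independent of $f$ with $\|\mathbf{H}_\mu(f)\|_{\theta,\beta}\le C\|f\|_{\theta,\alpha}$. For $s>0$, a positive Borel measure $\mu$ on $[0,1)$ is an $s$-Carleson measure if there is a constant $C_1>0$ such that $\mu([t,1))\le C_1(1-t)^s$ for all $t\in[0,1)$. *)

(* Defs.v *)
From HB Require Import structures.
From mathcomp Require Import all_boot all_order all_algebra.
From mathcomp Require Import all_classical all_reals all_analysis.
From mathcomp Require Import complex.

Set Implicit Arguments.
Unset Strict Implicit.
Unset Printing Implicit Defensive.

Import Order.TTheory GRing.Theory Num.Theory.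
Import numFieldNormedType.Exports.

Local Open Scope classical_set_scope.
Local Open Scope ring_scope.

(* The complex plane, ascribed to [numClosedFieldType]: the instances that give
   a number field the topology of its norm are keyed on that structure, not on
   the bare type [R[i]]. *)
Definition cplx (R : realType) : numClosedFieldType := R[i].

Definition ofR (R : realType) (x : R) : cplx R := x%:C%C.

(* [`|z|] is an element of [cplx R]; this is the modulus as a real number. *)
Definition modulus (R : realType) (z : cplx R) : R :=
  ComplexField.Normc.normc z.

(* Differentiability with respect to the field of scalars [cplx R], that is,
   complex differentiability, at every point. *)
Definition entire (R : realType) (f : cplx R -> cplx R) : Prop :=
  forall z : cplx R, derivable f z 1.

(* The coefficients a_n in f(z) = \sum_n a_n z^n, as a_n = f^(n)(0) / n!. *)
Definition coeff (R : realType) (f : cplx R -> cplx R) (n : nat) : cplx R :=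
  (f^`(n))%classic 0 / n`!%:R.

Definition sq_fock_norm (R : realType) (theta alpha : R) (f : cplx R -> cplx R)
    : \bar R :=
  (\sum_(0 <= n <oo)
     ((n%:R + theta) `^ alpha * modulus (coeff f n) ^+ 2 * n`!%:R)%:E)%E.

Definition fock (R : realType) (theta alpha : R) : set (cplx R -> cplx R) :=
  [set f | entire f /\ (sq_fock_norm theta alpha f < +oo)%E].

(* Meaningful on [fock theta alpha], where the square is finite. *)
Definition fock_norm (R : realType) (theta alpha : R) (f : cplx R -> cplx R)
    : R :=
  Num.sqrt (fine (sq_fock_norm theta alpha f)).

(* A measure on [0,1) is represented by a Borel measure on R that vanishes
   outside `[0, 1[; the definitions below only see its restriction to `[0, 1[. *)
Definition moment (R : realType)
    (mu : {measure set (measurableTypeR R) -> \bar R}) (n : nat) : R :=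
  Rintegral mu `[0, 1[ (fun t : R => t ^+ n).

Definition hilbert_summand (R : realType)
    (mu : {measure set (measurableTypeR R) -> \bar R})
    (f : cplx R -> cplx R) (n k : nat) : cplx R :=
  ofR (moment mu (k + n)) * coeff f k * ofR (Num.sqrt k`!%:R).

Definition hilbert_coeff (R : realType)
    (mu : {measure set (measurableTypeR R) -> \bar R})
    (f : cplx R -> cplx R) (n : nat) : cplx R :=
  (ofR (Num.sqrt n`!%:R))^-1 * limn (series (hilbert_summand mu f n)).

Definition hilbert_term (R : realType)
    (mu : {measure set (measurableTypeR R) -> \bar R})
    (f : cplx R -> cplx R) (z : cplx R) (n : nat) : cplx R :=
  hilbert_coeff mu f n * z ^+ n.

Definition hilbert_op (R : realType)
    (mu : {measure set (measurableTypeR R) -> \bar R})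
    (f : cplx R -> cplx R) : cplx R -> cplx R :=
  fun z => limn (series (hilbert_term mu f z)).

(* [limn] is total, so convergence of the coefficient series and of the
   resulting power series has to be required separately. *)
Definition hilbert_defined (R : realType)
    (mu : {measure set (measurableTypeR R) -> \bar R})
    (f : cplx R -> cplx R) : Prop :=
  (forall n, cvgn (series (hilbert_summand mu f n))) /\
  (forall z, cvgn (series (hilbert_term mu f z))).

Definition hilbert_bounded (R : realType)
    (mu : {measure set (measurableTypeR R) -> \bar R})
    (theta alpha beta : R) : Prop :=
  exists2 M : R, 0 < M &
    forall f, fock theta alpha f ->
      [/\ hilbert_defined mu f,
          fock theta beta (hilbert_op mu f) &
          fock_norm theta beta (hilbert_op mu f)
            <= M * fock_norm theta alpha f].

Definition carleson (R : realType) (s : R)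
    (mu : {measure set (measurableTypeR R) -> \bar R}) : Prop :=
  exists2 M : R, 0 < M &
    forall t : R, 0 <= t < 1 -> (mu `[t, 1%R[%classic <= (M * (1 - t) `^ s)%:E)%E.

(* Main.v *)
Require Import Defs.
From mathcomp Require Import all_boot all_order all_algebra.
From mathcomp Require Import all_classical all_reals all_analysis.
From mathcomp Require Import measurable_realfun complex ring lra.

Import Order.TTheory GRing.Theory Num.Theory.
Import numFieldNormedType.Exports.

Local Open Scope classical_set_scope.
Local Open Scope ring_scope.

(** Writing [f = \sum a_k z^k] and [x_k = a_k sqrt (k!)], the space
    [fock theta alpha] becomes the l2 space with weights [(k + theta)^alpha],
    comparable to [(k + 1)^alpha], and the operator becomes the Hankel matrix
    [(mu[n + k])] of the moments of [mu]. Put [a = (1 + alpha) / 2] and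
    [b = (1 + beta) / 2], which lie strictly between 0 and 1; the Carleson
    exponent is [s = 1 + b - a].

    Carleson implies bounded. Dominating [x^n] on [0, 1) by a step function
    with steps of width [1 / (n + 1)] gives [mu[n] = O ((n + 1)^-s)]
    ([carleson_moment]). The matrix with entries [(n + k + 1)^-s] is then
    handled by a Schur test with the powers [(k + 1)^-a] as test weights
    ([schur]); both of its conditions are instances of
    [\sum_k (k + 1)^-a (n + k + 1)^-(1 + b - a) = O ((n + 1)^-b)]
    ([kernel_sum]), the second one with [(1 - b, 1 - a)] in place of [(a, b)].

    Bounded implies Carleson. Testing on the polynomial with [x_k = 1] for
    [N <= k < 2 N] and [x_k = 0] elsewhere, for [N] of order [1 / (1 - t)],
    all the moments [mu[n + k]] with [n, k < 2 N] are at least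
    [mu [t, 1) / 2]; comparing the norms gives [mu [t, 1) = O (N^-s)]
    ([tail_le_of_bounded]).

    The operator only sees the Taylor coefficients of its argument, so no
    expansion theorem for entire functions is needed. What is needed of complex
    analysis is the converse construction: a power series with infinite radius
    of convergence is entire and has the expected coefficients
    ([entire_psum], [coeff_psum]), by termwise differentiation. *)

(** * The modulus on the complex plane *)

Section Modulus.
Context {R : realType}.
Implicit Types z w : cplx R.

Lemma normE_modulus z : `|z| = ofR (modulus z).
Proof. by case: z. Qed.

Lemma modulusE z : ofR (modulus z) = `|z|.
Proof. by rewrite normE_modulus. Qed.

Lemma ofR_inj : injective (@ofR R).
Proof. by move=> x y []. Qed.

Lemma ofR_le (x y : R) : (ofR x <= ofR y) = (x <= y).
Proof. exact: lecR. Qed.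

Lemma ofR_lt (x y : R) : (ofR x < ofR y) = (x < y).
Proof. exact: ltcR. Qed.

Lemma modulus_ge0 z : 0 <= modulus z.
Proof. by rewrite -ofR_le modulusE normr_ge0. Qed.

Lemma modulusM z w : modulus (z * w) = modulus z * modulus w.
Proof. exact: ComplexField.Normc.normcM. Qed.

Lemma modulusD z w : modulus (z + w) <= modulus z + modulus w.
Proof. exact: le_normcD. Qed.

Lemma modulusN z : modulus (- z) = modulus z.
Proof. by apply: ofR_inj; rewrite !modulusE normrN. Qed.

Lemma modulus_distC z w : modulus (z - w) = modulus (w - z).
Proof. by rewrite -modulusN opprB. Qed.

Lemma modulus0 : modulus (0 : cplx R) = 0.
Proof. exact: ComplexField.Normc.normc0. Qed.

Lemma modulus1 : modulus (1 : cplx R) = 1.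
Proof. exact: ComplexField.Normc.normc1. Qed.

Lemma modulusX z n : modulus (z ^+ n) = modulus z ^+ n.
Proof. by elim: n => [|n IH]; rewrite ?expr0 ?modulus1 // !exprS modulusM IH. Qed.

Lemma modulus_ofR (x : R) : modulus (ofR x) = `|x|.
Proof. by rewrite /modulus /ofR /= expr0n /= addr0 sqrtr_sqr. Qed.

Lemma ofR_nat n : ofR n%:R = n%:R :> cplx R.
Proof. exact: (rmorph_nat (real_complex R)). Qed.

Lemma modulus_nat n : modulus (n%:R : cplx R) = n%:R.
Proof. by rewrite -ofR_nat modulus_ofR ger0_norm. Qed.

Lemma modulusV z : modulus z^-1 = (modulus z)^-1.
Proof. exact: ComplexField.Normc.normcV. Qed.

Lemma modulus_sum (I : Type) (r : seq I) (P : pred I) (F : I -> cplx R) :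
  modulus (\sum_(i <- r | P i) F i) <= \sum_(i <- r | P i) modulus (F i).
Proof.
elim/big_rec2: _ => [|i y1 y2 _ h]; first by rewrite modulus0.
by apply: (le_trans (modulusD _ _)); rewrite lerD2l.
Qed.

Lemma modulus_Re_Im z : modulus z <= `|complex.Re z| + `|complex.Im z|.
Proof.
have e : z = ofR (complex.Re z) + (0 +i* 1)%C * ofR (complex.Im z).
  by rewrite [LHS]complexE.
rewrite {1}e; apply: (le_trans (modulusD _ _)).
rewrite modulusM !modulus_ofR lerD2l.
suff -> : modulus (0 +i* 1 : cplx R)%C = 1 by rewrite mul1r.
by rewrite /modulus /= expr0n /= expr1n add0r sqrtr1.
Qed.

Lemma Re_le_modulus z : `|complex.Re z| <= modulus z.
Proof. by rewrite -ofR_le modulusE; exact: normc_ge_Re. Qed.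

Lemma Im_le_modulus z : `|complex.Im z| <= modulus z.
Proof.
case: z => a b; rewrite /modulus /= -sqrtr_sqr ler_wsqrtr //.
by rewrite lerDr sqr_ge0.
Qed.

Lemma ofR_gt0P (e : cplx R) : 0 < e -> exists2 d : R, 0 < d & e = ofR d.
Proof.
case: e => a b; rewrite ltcE /= => /andP[/eqP -> a0]; by exists a.
Qed.

(** Convergence in the complex plane, with the distance read in the reals. *)
Lemma cvg_modulusP (u : nat -> cplx R) l :
  (u @ \oo --> l) <-> (modulus (u n - l) @[n --> \oo] --> (0 : R)).
Proof.
split => [/cvgrPdist_lt h|/cvgrPdist_lt h]; apply/cvgrPdist_lt => e e0.
- have e0' : 0 < ofR e by rewrite (ofR_lt 0).
  near=> n; rewrite sub0r normrN ger0_norm ?modulus_ge0//.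
  by rewrite -ofR_lt modulus_distC modulusE; near: n; exact: h.
- have [d d0 ->] := ofR_gt0P _ e0.
  near=> n; rewrite -modulusE ofR_lt modulus_distC.
  rewrite -[ltLHS]ger0_norm ?modulus_ge0// -normrN -sub0r.
  by near: n; exact: h.
Unshelve. all: by end_near. Qed.

Lemma cvg_modulus_le (u : nat -> cplx R) l B :
  (u @ \oo --> l) -> (forall n, modulus (u n) <= B) -> modulus l <= B.
Proof.
move=> /cvg_modulusP ul uB; apply/ler_addgt0Pr => e e0.
have /cvgrPdist_lt /(_ e e0) [N _ /(_ N (leqnn N))] := ul.
rewrite /= sub0r normrN ger0_norm ?modulus_ge0// => h.
rewrite -[l](subrK (u N)) [B + e]addrC; apply: (le_trans (modulusD _ _)).
by apply: lerD => //; rewrite modulus_distC ltW.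
Qed.

Lemma cvg_bounded_series (u : nat -> R) B : (forall n, 0 <= u n) ->
  (forall N, \sum_(0 <= k < N) u k <= B) -> cvgn (series u).
Proof.
move=> u0 uB; apply: nondecreasing_is_cvgn.
  by apply/nondecreasing_seqP => n; rewrite /series /= big_nat_recr //= lerDl.
by exists B => _ [n _ <-]; exact: uB.
Qed.

(** Absolute convergence, from the convergence of the real and imaginary
    parts. *)
Lemma cvg_abs_series (u : nat -> cplx R) B :
  (forall N, \sum_(0 <= k < N) modulus (u k) <= B) -> cvgn (series u).
Proof.
move=> uB.
have part (p : cplx R -> R) : (forall z, `|p z| <= modulus z) ->
    cvgn (series (p \o u)).
  move=> pm; apply: normed_cvg.
  apply: (@cvg_bounded_series _ B) => [n|N]; first exact: normr_ge0.
  apply: (le_trans _ (uB N)); apply: ler_sum => k _; exact: pm.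
have /cvg_ex[a ha] := part (@complex.Re R) Re_le_modulus.
have /cvg_ex[b hb] := part (@complex.Im R) Im_le_modulus.
apply/cvg_ex; exists (a +i* b)%C; apply/cvg_modulusP.
have h : `|series (@complex.Re R \o u) n - a| + `|series (@complex.Im R \o u) n - b|
    @[n --> \oo] --> (0 : R).
  rewrite -[0 : R]addr0; apply: cvgD.
    rewrite -[0 : R](@normr0 _ R) -[X in `|X|](subrr a); apply: cvg_norm.
    by apply: cvgB => //; apply: cvg_cst.
  rewrite -[0 : R](@normr0 _ R) -[X in `|X|](subrr b); apply: cvg_norm.
  by apply: cvgB => //; apply: cvg_cst.
apply: (@squeeze_cvgr _ _ _ _ (fun=> 0) _ _ _ _ (cvg_cst _) h).
near=> n; rewrite modulus_ge0 /=.
apply: (le_trans (modulus_Re_Im _)).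
rewrite /series /= !raddfB /=.
have -> : complex.Re (\sum_(0 <= k < n) u k) = \sum_(0 <= k < n) complex.Re (u k).
  by apply: (big_morph _ _ (erefl : complex.Re 0 = 0)) => -[? ?] [? ?].
have -> : complex.Im (\sum_(0 <= k < n) u k) = \sum_(0 <= k < n) complex.Im (u k).
  by apply: (big_morph _ _ (erefl : complex.Im 0 = 0)) => -[? ?] [? ?].
by [].
Unshelve. all: by end_near. Qed.

End Modulus.

(** * Power series with infinite radius of convergence *)

Section PowerSeries.
Context {R : realType}.
Implicit Types (c : nat -> cplx R) (z h : cplx R).

(** Infinite radius of convergence, expressed by Cauchy estimates on the
    coefficients: [c n] is [O (r ^- n)] for every [r]. *)
Definition rapid c := forall r : R, 0 <= r ->
  exists B, forall n, modulus (c n) * r ^+ n <= B.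

(** The sum of the power series; the limit is a default value where the
    series diverges, which never happens when [rapid c] holds. *)
Definition psum c z : cplx R := limn (series (fun n => c n * z ^+ n)).

(** The coefficients of the termwise derivative. *)
Definition pdiff c n : cplx R := n.+1%:R * c n.+1.

(** The estimate at radius [2 r] gives a geometric majorant at radius [r]. *)
Lemma rapid_sum c : rapid c -> forall r : R, 0 <= r ->
  exists B, forall N, \sum_(0 <= n < N) modulus (c n) * r ^+ n <= B.
Proof.
move=> rc r r0; have [|B hB] := rc (r * 2) ; first by rewrite mulr_ge0.
have B0 : 0 <= B by apply: (le_trans _ (hB 0)); rewrite expr0 mulr1 modulus_ge0.
exists (B * 2) => N.
suff : \sum_(0 <= n < N) modulus (c n) * r ^+ n <= B * (2 - 2 ^- N * 2).
  by move=> h; apply: (le_trans h); apply: ler_wpM2l => //; rewrite gerBl.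
elim: N => [|N IH]; first by rewrite big_nil expr0 invr1 mul1r subrr mulr0.
rewrite big_nat_recr //=.
have h : modulus (c N) * r ^+ N <= B * 2 ^- N.
  by rewrite ler_pdivlMr ?exprn_gt0 // -mulrA -exprMn.
apply: (le_trans (lerD IH h)); rewrite -mulrDr; apply: ler_wpM2l => //.
rewrite exprS invfM.
have : 0 <= (2 : R) ^- N by rewrite invr_ge0 exprn_ge0.
by lra.
Qed.

Lemma cvg_psum c z : rapid c -> series (fun n => c n * z ^+ n) @ \oo --> psum c z.
Proof.
move=> /rapid_sum /(_ _ (modulus_ge0 z)) [B hB].
suff : cvgn (series (fun n => c n * z ^+ n)) by [].
apply: (cvg_abs_series _ B) => N; apply: (le_trans _ (hB N)).
by apply: ler_sum => n _; rewrite modulusM modulusX.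
Qed.

Lemma psum0 c : psum c 0 = c 0.
Proof.
apply: cvg_lim => //; apply/cvgrPdist_lt => e e0; near=> n.
have n0 : (0 < n)%N by near: n; exists 1%N.
rewrite /series /= -(prednK n0) big_nat_recl // expr0 mulr1 big1 ?addr0 ?subrr ?normr0 //.
by move=> i _; rewrite exprS mul0r mulr0.
Unshelve. all: by end_near. Qed.

Lemma rapid_pdiff c : rapid c -> rapid (pdiff c).
Proof.
move=> rc r r0; have [|B hB] := rc ((r + 1) * 2).
  by rewrite mulr_ge0 // addr_ge0.
(* The factor [n + 1] is absorbed by [2 ^ (n + 1)], whence the radius. *)
exists B => n; apply: (le_trans _ (hB n.+1)).
rewrite /pdiff modulusM modulus_nat [_%:R * _]mulrC -mulrA; apply: ler_wpM2l.
  exact: modulus_ge0.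
rewrite exprMn mulrC; apply: ler_pM; rewrite ?exprn_ge0 //.
  rewrite exprS -[leLHS]mul1r; apply: ler_pM; rewrite ?exprn_ge0 ?lerDr //.
  by apply: lerXn2r; rewrite ?nnegrE ?addr_ge0 ?lerDl.
by rewrite -natrX ler_nat ltnW // ltn_expl.
Qed.

(** The second-order Taylor remainder of [z ^+ n]. *)
Lemma modulus_taylor2 z h n : modulus h <= 1 ->
  modulus ((z + h) ^+ n - z ^+ n - n%:R * z ^+ n.-1 * h)
  <= modulus h ^+ 2 * (modulus z + 1) ^+ n.
Proof.
move=> h1; set r := modulus z; set d := modulus h.
have r0 : 0 <= r by exact: modulus_ge0.
(* The same remainder at [r] with increment [1] obeys the same recursion, with
   nonnegative terms. *)
suff : modulus ((z + h) ^+ n - z ^+ n - n%:R * z ^+ n.-1 * h)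
    <= d ^+ 2 * ((r + 1) ^+ n - r ^+ n - n%:R * r ^+ n.-1).
  move=> H; apply: (le_trans H); apply: ler_wpM2l; first exact: sqr_ge0.
  have : 0 <= r ^+ n by exact: exprn_ge0.
  have : 0 <= n%:R * r ^+ n.-1 by rewrite mulr_ge0 ?exprn_ge0.
  by lra.
elim: n => [|n IH].
  by rewrite !expr0 !mul0r !subr0 !subrr modulus0 mulr0.
have -> : (z + h) ^+ n.+1 - z ^+ n.+1 - n.+1%:R * z ^+ n * h =
   (z + h) * ((z + h) ^+ n - z ^+ n - n%:R * z ^+ n.-1 * h)
     + n%:R * h ^+ 2 * z ^+ n.-1.
  by case: n {IH} => [|n]; rewrite ?expr0 ?exprS ?mulrS /=; ring.
have -> : (r + 1) ^+ n.+1 - r ^+ n.+1 - n.+1%:R * r ^+ n =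
   (r + 1) * ((r + 1) ^+ n - r ^+ n - n%:R * r ^+ n.-1)
     + n%:R * r ^+ n.-1.
  by case: n {IH} => [|n]; rewrite ?expr0 ?exprS ?mulrS /=; ring.
apply: (le_trans (modulusD _ _)); rewrite [leRHS]mulrDr; apply: lerD.
  rewrite modulusM mulrCA; apply: ler_pM; rewrite ?modulus_ge0 //.
  by apply: (le_trans (modulusD _ _)); rewrite lerD2l.
by rewrite !modulusM !modulusX modulus_nat -mulrA mulrCA.
Qed.

(** The constant bounds the partial sums of [\sum |c_n| (|z| + 1)^n]. *)
Lemma psum_taylor2 c z : rapid c -> exists B, forall h, modulus h <= 1 ->
  modulus (psum c (z + h) - psum c z - psum (pdiff c) z * h)
  <= modulus h ^+ 2 * B.
Proof.
move=> rc; have [|B hB] := rapid_sum c rc (modulus z + 1).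
  by rewrite addr_ge0 ?modulus_ge0.
exists B => h h1.
have cd : series (fun n => n%:R * c n * z ^+ n.-1) @ \oo --> psum (pdiff c) z.
  rewrite -cvg_shiftS /=; set v := (fun n => _).
  have -> : v = series (fun n => pdiff c n * z ^+ n).
    by apply/funext => n; rewrite /v /series /= big_nat_recl //= !mul0r add0r.
  exact: cvg_psum _ z (rapid_pdiff _ rc).
have cc : (fun N => \sum_(0 <= n < N)
     c n * ((z + h) ^+ n - z ^+ n - n%:R * z ^+ n.-1 * h))
   @ \oo --> psum c (z + h) - psum c z - psum (pdiff c) z * h.
  set v := (fun N => _).
  have -> : v = series (fun n => c n * (z + h) ^+ n) - series (fun n => c n * z ^+ n)
      - series (fun n => n%:R * c n * z ^+ n.-1) * cst h.
    apply/funext => N; rewrite /v !fctE /series /= mulr_suml -!sumrB.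
    by apply: eq_bigr => n _; ring.
  by apply: cvgB; [apply: cvgB; exact: cvg_psum|apply: cvgM; [exact: cd|exact: cvg_cst]].
apply: (cvg_modulus_le _ _ _ cc) => N.
apply: (le_trans (modulus_sum _ _ _ _)).
apply: (@le_trans _ _ (\sum_(0 <= n < N)
    modulus h ^+ 2 * (modulus (c n) * (modulus z + 1) ^+ n))).
  apply: ler_sum => n _; rewrite modulusM mulrCA; apply: ler_wpM2l.
    exact: modulus_ge0.
  exact: modulus_taylor2.
by rewrite -mulr_sumr; apply: ler_wpM2l => //; exact: sqr_ge0.
Unshelve. all: by end_near. Qed.

Lemma psum_quotient c z : rapid c ->
  h^-1 *: ((psum c \o shift z) h - psum c z) @[h --> 0^'] --> psum (pdiff c) z.
Proof.
move=> rc; have [B hB] := psum_taylor2 c z rc.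
have B0 : 0 <= B.
  have := hB 1; rewrite modulus1 expr1n mul1r => /(_ (lexx _)).
  by apply: le_trans; exact: modulus_ge0.
apply/cvgrPdist_lt => e0 /ofR_gt0P [e e_gt0 ->].
have d0 : 0 < Num.min 1 (e / (B + 1)).
  by rewrite lt_min ltr01 divr_gt0 // ltr_wpDl.
near=> h.
have hn0 : h != 0 by near: h; exact: nbhs_dnbhs_neq.
have hd : modulus h < Num.min 1 (e / (B + 1)).
  rewrite -ofR_lt modulusE; near: h.
  by apply: dnbhs0_lt; rewrite (ofR_lt 0).
have h1 : modulus h <= 1 by apply: ltW; apply: lt_le_trans hd _; rewrite ge_min lexx.
have h0 : 0 < modulus h.
  by rewrite -(ofR_lt 0) modulusE normr_gt0.
rewrite -modulusE ofR_lt modulus_distC /=.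
have -> : h^-1 *: (psum c (h + z) - psum c z) - psum (pdiff c) z
   = h^-1 * (psum c (z + h) - psum c z - psum (pdiff c) z * h).
  by rewrite /GRing.scale /= [h + z]addrC [RHS]mulrBr [X in _ = _ - X]mulrCA
    mulVf // mulr1.
rewrite modulusM modulusV mulrC ltr_pdivrMr //.
apply: (le_lt_trans (hB h h1)); rewrite expr2 -mulrA mulrC ltr_pM2r //.
apply: (@le_lt_trans _ _ (modulus h * (B + 1))).
  by apply: ler_wpM2l; rewrite ?modulus_ge0 ?lerDl.
rewrite -ltr_pdivlMr ?ltr_wpDl //.
by apply: lt_le_trans hd _; rewrite ge_min lexx orbT.
Unshelve. all: by end_near. Qed.

Lemma entire_psum c : rapid c -> entire (psum c).
Proof.
move=> rc z; apply: cvgP.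
under eq_fun do rewrite [_%:A]mulr1.
exact: psum_quotient.
Qed.

Lemma derive1_psum c : rapid c -> ((psum c)^`())%classic = psum (pdiff c).
Proof. by move=> rc; apply/funext => z; apply: cvg_lim => //; exact: psum_quotient. Qed.

Lemma iter_pdiff0 c n : iter n pdiff c 0 = n`!%:R * c n.
Proof.
suff h m : iter n pdiff c m * m`!%:R = (n + m)`!%:R * c (n + m)%N.
  by have := h 0; rewrite fact0 mulr1 addn0.
elim: n m => [|n IH] m; first by rewrite mulrC.
by rewrite iterS /pdiff mulrAC -natrM -factS mulrC IH addnS addSn.
Qed.

Lemma coeff_psum c n : rapid c -> coeff (psum c) n = c n.
Proof.
move=> rc; rewrite /coeff.
have h m : rapid (iter m pdiff c) /\ ((psum c)^`(m))%classic = psum (iter m pdiff c).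
  elim: m => [//|m [IH1 IH2]]; split; first exact: rapid_pdiff.
  by rewrite derive1nS IH2 derive1_psum.
rewrite (h n).2 psum0 iter_pdiff0 mulrAC divff ?mul1r // pnatr_eq0 -lt0n fact_gt0.
Qed.

End PowerSeries.

(** * Weights and sums of powers *)

Section RealSums.
Context {R : realType}.
Implicit Types a b g p x y : R.

(** For exponents in [-1, 1], numbers within a ratio [L] of each other have
    powers within the same ratio. *)
Lemma powR_dist x y g L : 0 < x -> 0 < y -> -1 <= g <= 1 ->
  x <= L * y -> y <= L * x -> x `^ g <= L * y `^ g.
Proof.
move=> x0 y0 /andP[g1 g2] xy yx.
have L0 : 0 < L by rewrite -(pmulr_lgt0 _ y0); exact: lt_le_trans xy.
have L1 : 1 <= L.
  have := le_trans xy (ler_wpM2l (ltW L0) yx).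
  rewrite mulrA -[leLHS]mul1r ler_pM2r // -expr2 => h.
  by rewrite -(@ler_pXn2r _ 2) ?nnegrE ?expr1n // ltW.
suff h : (x / y) `^ g <= L.
  rewrite -[in leLHS](divfK (lt0r_neq0 y0) x) powRM ?divr_ge0 ?(ltW x0) ?(ltW y0) //.
  by apply: ler_wpM2r => //; exact: powR_ge0.
have aux (u g' : R) : 0 <= g' <= 1 -> 0 <= u <= L -> u `^ g' <= L.
  move=> /andP[g0 g'1] /andP[u0 uL].
  apply: (@le_trans _ _ (L `^ g')).
    by apply: ge0_ler_powR; rewrite ?nnegrE ?(ltW L0).
  by apply: (le_trans (ler_powR L1 g'1)); rewrite powRr1 // ltW.
have [g0|g0] := leP 0 g.
  by apply: aux; rewrite ?g0 ?g2 // divr_ge0 ?(ltW x0) ?(ltW y0) //= ler_pdivrMr.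
have -> : x / y = (y / x) `^ (-1).
  by rewrite powR_inv1 ?divr_ge0 ?(ltW x0) ?(ltW y0) // invf_div.
rewrite -powRrM mulN1r; apply: aux; first by apply/andP; split; lra.
by rewrite divr_ge0 ?(ltW x0) ?(ltW y0) //= ler_pdivrMr.
Qed.

(** A constant at least [1], [theta] and [1 / theta], by which the weights
    [(n + theta) ^ g] and [(n + 1) ^ g] are comparable. *)
Definition weight_const (theta : R) : R := 1 + theta + theta^-1.

Lemma weight_const_gt0 theta : 0 < theta -> 0 < weight_const theta.
Proof. by move=> t0; rewrite /weight_const !addr_gt0 ?invr_gt0. Qed.

Lemma weight_cmp theta g n : 0 < theta -> -1 <= g <= 1 ->
  (n%:R + theta) `^ g <= weight_const theta * n.+1%:R `^ g /\
  n.+1%:R `^ g <= weight_const theta * (n%:R + theta) `^ g.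
Proof.
move=> t0 hg; have n0 : 0 <= n%:R :> R by [].
have tV : theta * theta^-1 = 1 by rewrite mulfV ?gt_eqF.
have tV0 : 0 < theta^-1 by rewrite invr_gt0.
have e1 : n%:R + theta <= weight_const theta * n.+1%:R.
  by rewrite -natr1 /weight_const; nra.
have e2 : n.+1%:R <= weight_const theta * (n%:R + theta).
  by rewrite -natr1 /weight_const; nra.
by split; apply: powR_dist => //; rewrite ltr_wpDl.
Qed.

(** A consequence of [1 + u <= exp u], used both for [u = - x] and for
    [u = p x]. *)
Lemma powR_1B_le x p : 0 <= x <= 1 -> 0 < p -> (1 - x) `^ p <= (1 + p * x)^-1.
Proof.
move=> /andP[x0 x1] p0.
have px : 0 < 1 + p * x by rewrite ltr_pwDl // mulr_ge0 // ltW.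
move: x1; rewrite le_eqVlt => /orP[/eqP -> |x1].
  by rewrite subrr powR0 ?gt_eqF // invr_ge0 mulr1 addr_ge0 // ltW.
have d0 : 0 < 1 - x by rewrite subr_gt0.
rewrite /powR gt_eqF //.
apply: (@le_trans _ _ (expR (- (p * x)))).
  rewrite ler_expR -mulrN; apply: ler_wpM2l; first exact: ltW.
  by apply: le_ln1Dx; rewrite ltrNl opprK.
by rewrite expRN lef_pV2 ?posrE ?expR_gt0 // expR_ge1Dx.
Qed.

Lemma powR_pred_le n p : 0 < p ->
  n%:R `^ p <= n.+1%:R `^ p * (1 + p * n.+1%:R^-1)^-1.
Proof.
move=> p0; have m0 : 0 < n.+1%:R :> R by [].
have -> : n%:R = n.+1%:R * (1 - n.+1%:R^-1) :> R.
  by rewrite mulrBr mulr1 mulfV ?gt_eqF // -natr1 addrK.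
have d : 0 <= (n.+1%:R^-1 : R) <= 1 by rewrite invr_ge0 ler0n invf_le1 ?ler1n.
rewrite powRM //; last by rewrite subr_ge0; case/andP: d.
by apply: ler_wpM2l; [exact: powR_ge0|exact: (powR_1B_le _ p)].
Qed.

(** Up to a constant, the summand is at most the increment of [k ^ p]. *)
Lemma sum_powR_small p n : 0 < p ->
  \sum_(0 <= k < n) k.+1%:R `^ (p - 1) <= (1 + p) / p * n%:R `^ p.
Proof.
move=> p0; have p1 : 0 < 1 + p by rewrite addr_gt0.
elim: n => [|n IH].
  by rewrite big_nil mulr_ge0 ?powR_ge0 // divr_ge0 // ltW.
rewrite big_nat_recr //=; apply: (le_trans (lerD IH (lexx _))).
rewrite -lerBrDl -mulrBr mulrAC ler_pdivlMr // mulrC.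
have m0 : 0 < n.+1%:R :> R by [].
have h := powR_pred_le n p p0.
set q := n.+1%:R `^ p in h *; set w := n.+1%:R^-1 in h.
have q0 : 0 <= q by exact: powR_ge0.
have w0 : 0 < w by rewrite invr_gt0.
have w1 : w <= 1 by rewrite invf_le1 ?ler1n.
have -> : n.+1%:R `^ (p - 1) = q * w.
  by rewrite powRD ?pnatr_eq0 ?implybT // powR_inv1.
have P0 : 0 < 1 + p * w by rewrite ltr_pwDl // mulr_ge0 // ltW.
rewrite ler_pdivlMr // in h.
have q1 : n%:R `^ p <= q by apply: ge0_ler_powR; rewrite ?nnegrE ?ler0n ?ler_nat ?ltW.
have := powR_ge0 (n%:R : R) p; move: h q1; set u := n%:R `^ p => h q1 u0.
have : p * w * (q - u) <= p * (q - u).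
  by apply: ler_wpM2r; rewrite ?subr_ge0 // -[leRHS]mulr1 ler_wpM2l // ltW.
by lra.
Qed.

(** The summand is at most the decrement of [k ^ - b], divided by [b]. *)
Lemma sum_powR_large b n N : 0 < b ->
  \sum_(n.+1 <= k < N) k.+1%:R `^ (- b - 1) <= b^-1 * n.+1%:R `^ (- b).
Proof.
move=> b0.
have [Nn|/ltnW nN] := leqP N n.+1.
  by rewrite big_geq // mulr_ge0 ?powR_ge0 // invr_ge0 ltW.
suff : \sum_(n.+1 <= k < N) k.+1%:R `^ (- b - 1) <=
    b^-1 * (n.+1%:R `^ (- b) - N%:R `^ (- b)).
  move=> h; apply: (le_trans h); apply: ler_wpM2l; first by rewrite invr_ge0 ltW.
  by rewrite gerBl powR_ge0.
elim: N nN => // N IH; rewrite leq_eqVlt => /orP[/eqP <-|nN].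
  by rewrite big_geq // subrr mulr0.
rewrite big_nat_recr //=; apply: (le_trans (lerD (IH nN) (lexx _))).
rewrite -lerBrDl -mulrBr.
rewrite (_ : _ - _ - (_ - _) = N%:R `^ (- b) - N.+1%:R `^ (- b)); last by ring.
have N0 : 0 < N%:R :> R by rewrite ltr0n; exact: (leq_ltn_trans (leq0n n) nN).
have h := powR_pred_le N b b0.
rewrite mulrC ler_pdivlMr //.
have w0 : 0 < (N.+1%:R^-1 : R) by rewrite invr_gt0.
have -> : N.+1%:R `^ (- b - 1) = N.+1%:R `^ (- b) * N.+1%:R^-1 :> R.
  by rewrite powRD ?pnatr_eq0 ?implybT // powR_inv1.
rewrite !powRN.
have u0 : 0 < (N%:R `^ b : R) by rewrite powR_gt0.
have q0 : 0 < (N.+1%:R `^ b : R) by rewrite powR_gt0.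
move: h u0 q0; set u := N%:R `^ b; set q := N.+1%:R `^ b => h u0 q0.
have P0 : 0 < 1 + b * N.+1%:R^-1 by rewrite ltr_pwDl // mulr_ge0 // ltW.
rewrite ler_pdivlMr // in h.
have : q^-1 * (1 + b * N.+1%:R^-1) <= u^-1.
  by rewrite -[leRHS]mul1r ler_pdivlMr // -mulrA ler_pdivrMl // mulr1 mulrC.
move: (q^-1) (u^-1) (N.+1%:R^-1 : R) => x y z; lra.
Qed.

(** The Schur estimate for the kernel [(n + k + 1) ^ - (1 + b - a)]: the range
    [k <= n] is summed with the kernel frozen at [n + 1], the range [k > n]
    with the kernel frozen at [k + 1]. *)
Lemma kernel_sum a b : 0 < a < 1 -> 0 < b < 1 ->
  exists2 C : R, 0 < C & forall n N,
  \sum_(0 <= k < N) k.+1%:R `^ (- a) * (n + k).+1%:R `^ (- (1 + b - a))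
   <= C * n.+1%:R `^ (- b).
Proof.
move=> /andP[a0 a1] /andP[b0 b1].
have p0 : 0 < 1 - a by rewrite subr_gt0.
have s0 : 0 <= 1 + b - a by lra.
exists ((1 + (1 - a)) / (1 - a) + b^-1).
  by rewrite addr_gt0 ?invr_gt0 // divr_gt0 // addr_gt0.
move=> n N.
have T k : 0 <= (k.+1%:R : R) `^ (- a) * (n + k).+1%:R `^ (- (1 + b - a)).
  by rewrite mulr_ge0 ?powR_ge0.
apply: (@le_trans _ _ (\sum_(0 <= k < n.+1 + N)
    k.+1%:R `^ (- a) * (n + k).+1%:R `^ (- (1 + b - a)))).
  rewrite [leRHS](@big_cat_nat _ _ _ N) ?leq_addl //= lerDl.
  by apply: sumr_ge0 => k _.
rewrite (@big_cat_nat _ _ _ n.+1) ?leq_addr //= mulrDl.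
have neg (x y : R) : 0 < x -> x <= y -> y `^ (- (1 + b - a)) <= x `^ (- (1 + b - a)).
  move=> x0 xy; rewrite !powRN lef_pV2 ?posrE ?powR_gt0 //; last exact: lt_le_trans xy.
  by apply: ge0_ler_powR; rewrite ?nnegrE ?(ltW x0) // ltW // (lt_le_trans x0).
apply: lerD.
  have := sum_powR_small (1 - a) n.+1 p0.
  rewrite (_ : 1 - a - 1 = - a); last by ring.
  move=> /(ler_wpM2r (powR_ge0 n.+1%:R (- (1 + b - a)))).
  rewrite -[(1 + (1 - a)) / (1 - a) * _ * _]mulrA -powRD ?pnatr_eq0 ?implybT //.
  rewrite (_ : 1 - a - (1 + b - a) = - b); last by ring.
  apply: le_trans; rewrite mulr_suml; apply: ler_sum => k _.
  apply: ler_wpM2l; first exact: powR_ge0.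
  by apply: neg => //; rewrite ler_nat ltnS leq_addr.
apply: le_trans (sum_powR_large b n (n.+1 + N) b0).
apply: ler_sum => k _; rewrite (_ : - b - 1 = - a - (1 + b - a)); last by ring.
rewrite [leRHS]powRD ?pnatr_eq0 ?implybT //.
apply: ler_wpM2l; first exact: powR_ge0.
by apply: neg => //; rewrite ler_nat ltnS leq_addl.
Qed.

End RealSums.

(** * Moments of a finite measure on [0, 1) *)

Section Moments.
Context {R : realType} (mu : {finite_measure set (measurableTypeR R) -> \bar R}).
Local Notation D := (`[0, 1[%classic : set (measurableTypeR R)).
Local Notation tail t := (`[t, 1[%classic : set (measurableTypeR R)).

Lemma tail_fin (t : R) : mu (tail t) \is a fin_num.
Proof. by apply: fin_num_measure; exact: measurable_itv. Qed.

(** Integrals of combinations of indicators of intervals ending at 1. *)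
Lemma integral_steps (c t : nat -> R) N : (forall k, 0 <= c k) ->
  (forall k, (k < N)%N -> 0 <= t k) ->
  (\int[mu]_(x in D) (\sum_(0 <= k < N) (c k * \1_(tail (t k)) x))%:E =
   \sum_(0 <= k < N) (c k)%:E * mu (tail (t k)))%E.
Proof.
move=> c0 t0.
under eq_integral do rewrite -sumEFin.
rewrite ge0_integral_sum //=.
- apply: eq_big_nat => k /andP[_ kN].
  under eq_integral do rewrite EFinM.
  rewrite ge0_integralZl_EFin //.
  + rewrite integral_indic //.
    rewrite (_ : _ `&` _ = tail (t k)) //; apply/setIidPl => x /=.
    rewrite !in_itv /= => /andP[h1 ->]; rewrite andbT.
    exact: le_trans (t0 k kN) h1.
  + by apply/measurable_EFinP; apply: measurable_indic.
- by move=> k; apply/measurable_EFinP; apply: measurable_funM.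
- by move=> k x _; rewrite lee_fin mulr_ge0.
Qed.

Lemma moment_EFin n : ((moment mu n)%:E = \int[mu]_(x in D) (x ^+ n)%:E)%E.
Proof.
rewrite /moment /Rintegral fineK // ge0_fin_numE; last first.
  apply: integral_ge0 => x /=; rewrite in_itv /= => /andP[x0 _].
  by rewrite lee_fin exprn_ge0.
apply: (@le_lt_trans _ _ (\int[mu]_(x in D) (cst 1 x))%E).
  apply: ge0_le_integral => //.
  - by move=> x /=; rewrite in_itv /= => /andP[x0 _]; rewrite lee_fin exprn_ge0.
  - by apply/measurable_EFinP; apply: measurable_funX; exact: measurable_id.
  - move=> x /=; rewrite in_itv /= => /andP[x0 x1].
    by rewrite lee_fin exprn_ile1 // ltW.
rewrite integral_cst // mul1e ltey_eq; apply/orP; left.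
by rewrite tail_fin.
Qed.

Lemma moment_ge0 n : 0 <= moment mu n.
Proof.
rewrite -lee_fin moment_EFin; apply: integral_ge0 => x /=.
by rewrite in_itv /= => /andP[x0 _]; rewrite lee_fin exprn_ge0.
Qed.

Lemma moment_le_mass n : moment mu n <= fine (mu D).
Proof.
rewrite -lee_fin moment_EFin fineK ?tail_fin //.
rewrite -[leRHS]mul1e -integral_cst //; apply: ge0_le_integral => //.
- by move=> x /=; rewrite in_itv /= => /andP[x0 _]; rewrite lee_fin exprn_ge0.
- by apply/measurable_EFinP; apply: measurable_funX; exact: measurable_id.
- move=> x /=; rewrite in_itv /= => /andP[x0 x1].
  by rewrite lee_fin exprn_ile1 // ltW.
Qed.

Lemma moment_ge_tail (t : R) n : 0 <= t < 1 -> t ^+ n * fine (mu (tail t)) <= moment mu n.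
Proof.
move=> /andP[t0 t1].
rewrite -lee_fin EFinM moment_EFin fineK ?tail_fin //.
have := integral_steps (fun=> t ^+ n) (fun=> t) 1 (fun=> exprn_ge0 n t0) (fun k _ => t0).
under eq_integral do rewrite big_nat1.
rewrite big_nat1 => <-; apply: ge0_le_integral => //.
- by move=> x _; rewrite lee_fin mulr_ge0 // exprn_ge0.
- by apply/measurable_EFinP; exact: measurable_funM.
- by apply/measurable_EFinP; apply: measurable_funX; exact: measurable_id.
- move=> x /=; rewrite lee_fin indicE => xD.
  have x0 : 0 <= x by move: xD; rewrite in_itv /= => /andP[].
  case: (boolP (x \in _)) => [|_]; last by rewrite mulr0 exprn_ge0.
  rewrite inE /= in_itv /= mulr1 => /andP[tx _].
  by apply: lerXn2r; rewrite ?nnegrE.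
Qed.

(** The integer part, except that the right end [y = n + 1] is put in the last
    interval. *)
Lemma nat_floor_le (y : R) n : 0 <= y <= n.+1%:R ->
  exists2 k, (k <= n)%N & k%:R <= y <= k.+1%:R.
Proof.
elim: n => [|n IH] /andP[y0 yn]; first by exists 0%N => //; rewrite y0.
have [yle|ylt] := leP y n.+1%:R.
  by have [|k kn hk] := IH; [rewrite y0|exists k => //; exact: leqW].
by exists n.+1 => //; rewrite yn ltW.
Qed.

(** The left side is at most [exp (- j / 2)], and
    [exp (j / 8) >= 1 + j / 8 >= (j + 1) / 8]. *)
Lemma step_height_le (j n : nat) : (j <= n)%N ->
  (1 - j%:R / n.+1%:R) ^+ n <= 8 ^+ 4 / j.+1%:R ^+ 4 :> R.
Proof.
move=> jn; have [n00|npos] := posnP n.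
  move: jn; rewrite n00 leqn0 => /eqP ->; rewrite expr0 expr1n divr1.
  by rewrite exprn_ege1 // ler1n.
have n0 : 0 < n.+1%:R :> R by [].
have d0 : 0 <= j%:R / n.+1%:R :> R by rewrite divr_ge0.
have d1 : 0 <= 1 - j%:R / n.+1%:R :> R.
  by rewrite subr_ge0 ler_pdivrMr // mul1r ler_nat leqW.
have e1 : 1 - j%:R / n.+1%:R <= expR (- (j%:R / n.+1%:R)) :> R.
  by have := expR_ge1Dx (- (j%:R / n.+1%:R) : R).
apply: (@le_trans _ _ (expR (- (j%:R / n.+1%:R)) ^+ n)).
  by apply: lerXn2r; rewrite ?nnegrE ?expR_ge0.
rewrite -expRM_natl.
apply: (@le_trans _ _ (expR (- (j%:R / 8)) ^+ 4)).
  rewrite -expRM_natl ler_expR !mulrN lerN2 mulrCA [X in _ <= X]mulrCA.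
  apply: ler_wpM2l => //.
  rewrite ler_pdivlMr //; have : 1 <= n%:R :> R by rewrite ler1n.
  by rewrite -natr1; lra.
have -> : 8 ^+ 4 / j.+1%:R ^+ 4 = ((j.+1%:R / 8) ^+ 4)^-1 :> R.
  by rewrite expr_div_n invf_div.
rewrite expRN exprVn lef_pV2 ?posrE ?exprn_gt0 ?expR_gt0 ?divr_gt0 //.
apply: lerXn2r; rewrite ?nnegrE ?expR_ge0 ?divr_ge0 //.
apply: le_trans (expR_ge1Dx _); rewrite -natr1.
have : 0 <= j%:R :> R by [].
by lra.
Qed.

Lemma sum_invsq_le N : \sum_(0 <= j < N) (j.+1%:R ^+ 2)^-1 <= 2 :> R.
Proof.
suff : \sum_(0 <= j < N) (j.+1%:R ^+ 2)^-1 <= 2 - 2 / N.+1%:R :> R.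
  by move=> h; apply: (le_trans h); rewrite gerBl divr_ge0.
elim: N => [|N IH]; first by rewrite big_nil divr1 subrr.
rewrite big_nat_recr //=; apply: (le_trans (lerD IH (lexx _))).
have [n0 m0] : 0 < N.+1%:R :> R /\ 0 < N.+2%:R :> R by [].
have : (N.+1%:R ^+ 2)^-1 <= 2 / N.+1%:R - 2 / N.+2%:R :> R.
  have -> : 2 / N.+1%:R - 2 / N.+2%:R = 2 / (N.+1%:R * N.+2%:R) :> R.
    have -> : 2 / N.+1%:R = 2 * N.+2%:R / (N.+1%:R * N.+2%:R) :> R.
      by rewrite -mulf_div divff ?gt_eqF // mulr1.
    have -> : 2 / N.+2%:R = 2 * N.+1%:R / (N.+1%:R * N.+2%:R) :> R.
      by rewrite [N.+1%:R * N.+2%:R]mulrC -mulf_div divff ?gt_eqF // mulr1.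
    by rewrite -mulrBl -mulrBr -natrB // subSnn mulr1.
  rewrite ler_pdivlMr ?mulr_gt0 // mulrC ler_pdivrMr ?exprn_gt0 //.
  by rewrite -natrM -natrX -natrM ler_nat -mulnn mulnCA leq_mul2l mul2n
    -addnn addSn ltnS leq_addl orbT.
by move=> h; rewrite -addrA lerD2l addrC lerBlDr addrC.
Qed.

(** The moments of an [s]-Carleson measure decay like [n ^- s]: the integrand
    [x ^ n] is dominated by the step function with steps of width
    [1 / (n + 1)]. *)
Lemma carleson_moment s : 0 <= s <= 2 -> carleson s mu ->
  exists2 C : R, 0 < C & forall n, moment mu n <= C * n.+1%:R `^ (- s).
Proof.
move=> /andP[s0 s2] [M M0 hM]; exists (2 * 8 ^+ 4 * M); first by rewrite !mulr_gt0.
move=> n; have n0 : 0 < n.+1%:R :> R by [].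
pose c j := if (j <= n)%N then (1 - j%:R / n.+1%:R : R) ^+ n else 0.
pose t j : R := 1 - j.+1%:R / n.+1%:R.
have j1 (j : nat) : (j <= n.+1)%N -> 0 <= 1 - j%:R / n.+1%:R :> R.
  by move=> jn; rewrite subr_ge0 ler_pdivrMr // mul1r ler_nat.
have c0 j : 0 <= c j.
  by rewrite /c; case: ifP => // jn; rewrite exprn_ge0 // j1 // leqW.
have t0 j : (j < n.+1)%N -> 0 <= t j by exact: j1.
rewrite -lee_fin moment_EFin.
apply: (@le_trans _ _ (\int[mu]_(x in D)
    (\sum_(0 <= k < n.+1) (c k * \1_(tail (t k)) x))%:E)%E).
  apply: ge0_le_integral => //.
  - by move=> x /=; rewrite in_itv /= => /andP[x0 _]; rewrite lee_fin exprn_ge0.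
  - by apply/measurable_EFinP; apply: measurable_funX; exact: measurable_id.
  - by apply/measurable_EFinP; apply: measurable_sum => k; exact: measurable_funM.
  move=> x /=; rewrite in_itv /= => /andP[x0 x1]; rewrite lee_fin.
  have [|k kn /andP[h1 h2]] := nat_floor_le (n.+1%:R * (1 - x)) n.
    by rewrite mulr_ge0 ?subr_ge0 ?(ltW x1) //= -[leRHS]mulr1 ler_wpM2l // gerBl.
  have h1' : x <= 1 - k%:R / n.+1%:R.
    by rewrite lerBrDl -lerBrDr ler_pdivrMr // mulrC.
  have h2' : t k <= x.
    by rewrite /t lerBlDl -lerBlDr ler_pdivlMr // mulrC.
  rewrite big_mkord (bigD1 (Ordinal (kn : (k < n.+1)%N))) //=.
  apply: (@le_trans _ _ (c k * \1_(tail (t k)) x)); last first.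
    by rewrite lerDl sumr_ge0 // => i _; rewrite mulr_ge0.
  rewrite indicE mem_set ?mulr1 /=; last by rewrite in_itv /= h2' x1.
  by rewrite /c kn; apply: lerXn2r; rewrite ?nnegrE ?(le_trans x0).
rewrite integral_steps //.
apply: (@le_trans _ _ (\sum_(0 <= k < n.+1)
    (8 ^+ 4 * M * n.+1%:R `^ (- s) * (k.+1%:R ^+ 2)^-1)%:E)%E).
  rewrite [leLHS]big_nat [leRHS]big_nat.
  apply: lee_sum => k /andP[_ kn].
  have ht : 0 <= t k < 1 by rewrite t0 //= gtrBl divr_gt0.
  apply: (@le_trans _ _ ((c k)%:E * (M * (1 - t k) `^ s)%:E)%E).
    by apply: lee_wpmul2l; rewrite ?lee_fin //; exact: hM.
  rewrite -EFinM lee_fin.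
  have -> : 1 - t k = k.+1%:R * n.+1%:R^-1 by rewrite /t subKr.
  rewrite powRM // ?invr_ge0 // -[n.+1%:R^-1]powR_inv1 // -powRrM mulN1r.
  (* As [s <= 2], two of the four powers in the bound for [c k] remain. *)
  have main : c k * k.+1%:R `^ s <= 8 ^+ 4 * (k.+1%:R ^+ 2)^-1.
    apply: (@le_trans _ _ (8 ^+ 4 / k.+1%:R ^+ 4 * k.+1%:R ^+ 2)).
      apply: ler_pM; rewrite ?powR_ge0 //.
        by rewrite /c -ltnS kn step_height_le.
      by rewrite -powR_mulrn // ler_powR ?ler1n.
    by rewrite (_ : 4 = 2 + 2)%N // [k.+1%:R ^+ (2 + 2)]exprD invfM -!mulrA
      mulVf ?mulr1 //.
  have := ler_wpM2l (mulr_ge0 (ltW M0) (powR_ge0 (n.+1%:R : R) (- s))) main.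
  by congr (_ <= _); ring.
rewrite sumEFin lee_fin -mulr_sumr.
have := sum_invsq_le n.+1.
set S := \sum_(_ <= _ < _) _ => hS.
have p0 := powR_ge0 (n.+1%:R : R) (- s).
have Q0 : 0 <= 8 ^+ 4 * M * n.+1%:R `^ (- s) by rewrite !mulr_ge0 // ltW.
by apply: (le_trans (ler_wpM2l Q0 hS)); rewrite mulrC !mulrA.
Qed.

End Moments.

(** * The Schur test *)

Section Schur.
Context {R : realType}.

(** Cauchy-Schwarz, with the factorisation of the terms left implicit. *)
Lemma sum_sq_le (z p q : nat -> R) N : (forall k, 0 <= p k) ->
  (forall k, 0 <= q k) -> (forall k, z k ^+ 2 <= p k * q k) ->
  (\sum_(0 <= k < N) z k) ^+ 2 <=
  (\sum_(0 <= k < N) p k) * (\sum_(0 <= k < N) q k).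
Proof.
move=> p0 q0 zpq; elim: N => [|N IH].
  by rewrite !big_nil expr0n /= mulr0.
rewrite !big_nat_recr //=.
have P0 : 0 <= \sum_(0 <= k < N) p k by exact: sumr_ge0.
have Q0 : 0 <= \sum_(0 <= k < N) q k by exact: sumr_ge0.
move: IH P0 Q0 (p0 N) (q0 N) (zpq N).
move: (\sum_(0 <= k < N) z k) (\sum_(0 <= k < N) p k) (\sum_(0 <= k < N) q k).
move: (z N) (p N) (q N) => a b c Z P Q hZ P0 Q0 b0 c0 ha.
(* By the arithmetic-geometric mean of [P c] and [b Q]. *)
have cross : 2 * (Z * a) <= P * c + b * Q.
  have PQ0 : 0 <= P * c + b * Q by rewrite addr_ge0 ?mulr_ge0.
  have [h|h] := leP (Z * a) 0; first by lra.
  have h1 : (Z * a) ^+ 2 <= (P * Q) * (b * c).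
    by rewrite exprMn; apply: ler_pM; rewrite ?sqr_ge0.
  rewrite -(@ler_pXn2r _ 2) ?nnegrE //; last by lra.
  have : 0 <= (P * c - b * Q) ^+ 2 by exact: sqr_ge0.
  by nra.
by nra.
Qed.

(** Schur test for Hankel matrices on weighted sequence spaces, with the powers
    of [k + 1] as test weights. The weight exponents [2 a - 1] and [2 b - 1] range
    over (-1, 1). *)
Lemma schur (a b C0 : R) (m : nat -> R) : 0 < a < 1 -> 0 < b < 1 -> 0 < C0 ->
  (forall n, 0 <= m n <= C0 * n.+1%:R `^ (- (1 + b - a))) ->
  exists2 K : R, 0 < K & forall (x : nat -> R) A,
    (forall k, 0 <= x k) ->
    (forall N, \sum_(0 <= k < N) k.+1%:R `^ (2 * a - 1) * x k ^+ 2 <= A) ->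
    forall N N', \sum_(0 <= n < N) n.+1%:R `^ (2 * b - 1) *
      (\sum_(0 <= k < N') m (k + n)%N * x k) ^+ 2 <= K * A.
Proof.
move=> ha hb C00 hm.
have [C1 C10 hC1] := kernel_sum a b ha hb.
have [C2 C20 hC2] : exists2 C : R, 0 < C & forall n N,
    \sum_(0 <= k < N) k.+1%:R `^ (- (1 - b)) * (n + k).+1%:R `^ (- (1 + b - a))
      <= C * n.+1%:R `^ (- (1 - a)).
  have [||C C0' h] := kernel_sum (1 - b) (1 - a).
  - by case/andP: hb => *; apply/andP; split; lra.
  - by case/andP: ha => *; apply/andP; split; lra.
  exists C => // n N; apply: le_trans (h n N).
  by rewrite (_ : 1 + (1 - a) - (1 - b) = 1 + b - a) //; ring.
exists (C0 ^+ 2 * C1 * C2); first by rewrite !mulr_gt0 // exprn_gt0.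
move=> x A x0 hA N N'.
pose s := 1 + b - a.
pose kap n k : R := (n + k).+1%:R `^ (- s).
have kap0 n k : 0 <= kap n k by exact: powR_ge0.
(* Cauchy-Schwarz along a row, split as
   [(kap (k + 1)^-a) (kap (k + 1)^a x_k^2)]. *)
have row n : (\sum_(0 <= k < N') m (k + n)%N * x k) ^+ 2 <=
    C0 ^+ 2 * (C1 * n.+1%:R `^ (- b)) *
      \sum_(0 <= k < N') kap n k * (k.+1%:R `^ a * x k ^+ 2).
  apply: (@le_trans _ _ ((\sum_(0 <= k < N') C0 ^+ 2 * (k.+1%:R `^ (- a) * kap n k)) *
      \sum_(0 <= k < N') kap n k * (k.+1%:R `^ a * x k ^+ 2))).
    apply: sum_sq_le => k.
    - by rewrite !mulr_ge0 ?powR_ge0 ?exprn_ge0 // ltW.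
    - by rewrite !mulr_ge0 ?powR_ge0 ?exprn_ge0.
    have -> : C0 ^+ 2 * (k.+1%:R `^ (- a) * kap n k) *
          (kap n k * (k.+1%:R `^ a * x k ^+ 2))
        = (k.+1%:R `^ (- a) * k.+1%:R `^ a) * (C0 * kap n k * x k) ^+ 2 by ring.
    rewrite -powRD ?pnatr_eq0 ?implybT // addNr powRr0 mul1r.
    have /andP[m0 m1] := hm (k + n)%N.
    apply: lerXn2r; rewrite ?nnegrE ?mulr_ge0 ?(ltW C00) //.
    by rewrite ler_wpM2r // /kap [(n + k)%N]addnC.
  apply: ler_wpM2r.
    by apply: sumr_ge0 => k _; rewrite !mulr_ge0 ?powR_ge0 ?exprn_ge0.
  by rewrite -mulr_sumr ler_wpM2l ?exprn_ge0 ?(ltW C00) //; exact: hC1.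
apply: (@le_trans _ _ (\sum_(0 <= n < N) \sum_(0 <= k < N')
   C0 ^+ 2 * C1 * (k.+1%:R `^ a * x k ^+ 2) * (n.+1%:R `^ (- (1 - b)) * kap k n))).
  apply: ler_sum => n _.
  apply: (le_trans (ler_wpM2l (powR_ge0 _ _) (row n))).
  rewrite !mulr_sumr; apply: ler_sum => k _.
  have -> : kap k n = kap n k by rewrite /kap addnC.
  have -> : - (1 - b) = (2 * b - 1) + - b by ring.
  rewrite [_ `^ (2 * b - 1 - b)]powRD ?pnatr_eq0 ?implybT //.
  by rewrite le_eqVlt; apply/orP; left; apply/eqP; ring.
(* After exchanging the sums, the inner one is a column sum, to which the
   kernel estimate applies with [(1 - b, 1 - a)]. *)
rewrite exchange_big /=.
apply: (@le_trans _ _ (\sum_(0 <= k < N') C0 ^+ 2 * C1 * C2 *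
    (k.+1%:R `^ (2 * a - 1) * x k ^+ 2))); last first.
  rewrite -mulr_sumr ler_wpM2l // !mulr_ge0 ?exprn_ge0 //;
    by rewrite ltW ?C00 ?C10 ?C20.
apply: ler_sum => k _; rewrite -mulr_sumr.
have -> : 2 * a - 1 = a + - (1 - a) by ring.
rewrite powRD ?pnatr_eq0 ?implybT //.
have h0 : 0 <= C0 ^+ 2 * C1 * (k.+1%:R `^ a * x k ^+ 2).
  by rewrite !mulr_ge0 ?exprn_ge0 ?powR_ge0 // ?(ltW C00) ?(ltW C10).
apply: (le_trans (ler_wpM2l h0 (hC2 k N))).
by rewrite le_eqVlt; apply/orP; left; apply/eqP; ring.
Qed.

End Schur.

(** * The weighted Fock norm *)

Section FockBasics.
Context {R : realType}.

Lemma cvg_modulus (u : nat -> cplx R) l :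
  u @ \oo --> l -> modulus (u n) @[n --> \oo] --> modulus l.
Proof.
move=> /cvg_modulusP /cvgrPdist_lt h; apply/cvgrPdist_lt => e e0.
near=> n; apply: (@le_lt_trans _ _ (modulus (u n - l))); last first.
  rewrite -[ltLHS]ger0_norm ?modulus_ge0// -normrN -sub0r.
  by near: n; exact: h.
have h1 := modulusD (u n - l) l; rewrite subrK in h1.
have h2 := modulusD (l - u n) (u n); rewrite subrK modulus_distC in h2.
by rewrite ler_norml; apply/andP; split; lra.
Unshelve. all: by end_near. Qed.

Lemma cvg_weighted_sum (w : nat -> R) (u : nat -> nat -> cplx R) l N :
  (forall n, u n @ \oo --> l n) ->
  \sum_(0 <= n < N) w n * modulus (u n K) ^+ 2 @[K --> \oo] -->
  \sum_(0 <= n < N) w n * modulus (l n) ^+ 2.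
Proof.
move=> ul; elim: N => [|N IH].
  by under eq_fun do rewrite big_nil; rewrite big_nil; exact: cvg_cst.
under eq_fun do rewrite big_nat_recr //=.
rewrite big_nat_recr //=; apply: cvgD => //; apply: cvgM; first exact: cvg_cst.
apply: (@cvg_comp _ _ _ _ (fun x : R => x ^+ 2)); first exact: cvg_modulus (ul N).
exact: exprn_continuous.
Qed.

Lemma factX_le_expR (r : R) n : 0 <= r -> r ^+ n / n`!%:R <= expR r.
Proof.
move=> r0; case: n => [|n].
  rewrite fact0 expr0 divr1; apply: le_trans (expR_ge1Dx r).
  by rewrite lerDl.
by apply: le_trans (expR_ge1Dxn n r0); rewrite lerDr.
Qed.

(** A bound on [|c_n|^2 n! / (n + 1)] is enough for an infinite radius of
    convergence, because [r ^ n / n! <= exp r]. *)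
Lemma rapid_of_fact (c : nat -> cplx R) B :
  (forall n, modulus (c n) ^+ 2 * n`!%:R <= B * n.+1%:R) -> rapid c.
Proof.
move=> hB r r0; exists (B * expR (2 * r ^+ 2) + 1) => n.
have f0 : 0 < n`!%:R :> R by rewrite ltr0n fact_gt0.
have B0 : 0 <= B.
  have := hB 0%N; rewrite fact0 !mulr1; apply: le_trans; exact: sqr_ge0.
suff h : (modulus (c n) * r ^+ n) ^+ 2 <= B * expR (2 * r ^+ 2).
  by have := sqr_ge0 (modulus (c n) * r ^+ n - 1); nra.
have r20 : 0 <= 2 * r ^+ 2 by rewrite mulr_ge0 // sqr_ge0.
apply: (@le_trans _ _ (B * ((2 * r ^+ 2) ^+ n / n`!%:R))); last first.
  by rewrite ler_wpM2l // factX_le_expR.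
rewrite mulrA ler_pdivlMr // exprMn mulrAC -exprM mulnC exprM.
rewrite [(2 * _) ^+ n]exprMn mulrA; apply: ler_wpM2r.
  by rewrite exprn_ge0 // sqr_ge0.
apply: (le_trans (hB n)); rewrite ler_wpM2l // -natrX ler_nat.
exact: ltn_expl.
Qed.

Lemma sq_fock_term_ge0 theta alpha (f : cplx R -> cplx R) n :
  0 <= (n%:R + theta) `^ alpha * modulus (coeff f n) ^+ 2 * n`!%:R.
Proof. by rewrite !mulr_ge0 ?powR_ge0 ?modulus_ge0. Qed.

Lemma sq_fock_norm_ge theta alpha (f : cplx R -> cplx R) N :
  ((\sum_(0 <= n < N) (n%:R + theta) `^ alpha * modulus (coeff f n) ^+ 2 * n`!%:R)%:E
   <= sq_fock_norm theta alpha f)%E.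
Proof.
rewrite /sq_fock_norm -sumEFin; apply: nneseries_lim_ge => n _ _.
by rewrite lee_fin sq_fock_term_ge0.
Qed.

Lemma sq_fock_norm_le theta alpha (f : cplx R -> cplx R) (B : R) :
  (forall N, \sum_(0 <= n < N)
     (n%:R + theta) `^ alpha * modulus (coeff f n) ^+ 2 * n`!%:R <= B) ->
  (sq_fock_norm theta alpha f <= B%:E)%E.
Proof.
move=> hB; apply: lime_le.
  by apply: is_cvg_nneseries => n _ _; rewrite lee_fin sq_fock_term_ge0.
by near=> N; rewrite sumEFin lee_fin.
Unshelve. all: by end_near. Qed.

Lemma sq_fock_norm_ge0 theta alpha (f : cplx R -> cplx R) :
  (0 <= sq_fock_norm theta alpha f)%E.
Proof. by have := sq_fock_norm_ge theta alpha f 0; rewrite big_nil. Qed.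

Lemma sq_fock_norm_fineK theta alpha (f : cplx R -> cplx R) :
  fock theta alpha f ->
  (fine (sq_fock_norm theta alpha f))%:E = sq_fock_norm theta alpha f.
Proof. by case=> _ h; rewrite fineK // ge0_fin_numE // sq_fock_norm_ge0. Qed.

(** The Fock norm controls the normalised coefficients [a_k sqrt (k!)] with
    the weights [(k + 1) ^ alpha]. *)
Lemma weighted_sum_le theta alpha (f : cplx R -> cplx R) N :
  0 < theta -> -1 <= alpha <= 1 -> fock theta alpha f ->
  \sum_(0 <= k < N) k.+1%:R `^ alpha * (modulus (coeff f k) * Num.sqrt k`!%:R) ^+ 2
  <= weight_const theta * fine (sq_fock_norm theta alpha f).
Proof.
move=> t0 ha ff; apply: (@le_trans _ _ (weight_const theta * \sum_(0 <= n < N)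
    (n%:R + theta) `^ alpha * modulus (coeff f n) ^+ 2 * n`!%:R)).
  rewrite mulr_sumr; apply: ler_sum => k _.
  rewrite exprMn sqr_sqrtr ?ler0n // !mulrA !ler_wpM2r ?modulus_ge0 //.
  exact: (weight_cmp theta alpha k t0 ha).2.
rewrite ler_wpM2l ?(ltW (weight_const_gt0 _ t0)) // -lee_fin sq_fock_norm_fineK //.
exact: sq_fock_norm_ge.
Qed.

End FockBasics.

(** * Boundedness and the Carleson condition *)

Section Equivalence.
Context {R : realType} (mu : {finite_measure set (measurableTypeR R) -> \bar R}).
Context (alpha beta theta : R).
Context (halpha : -1 < alpha < 1) (hbeta : -1 < beta < 1) (htheta : 0 < theta).

Let halpha' : -1 <= alpha <= 1.
Proof. by case/andP: halpha => *; rewrite !ltW. Qed.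

Let hbeta' : -1 <= beta <= 1.
Proof. by case/andP: hbeta => *; rewrite !ltW. Qed.

Lemma modulus_hilbert_summand f n k :
  modulus (hilbert_summand mu f n k) =
  moment mu (k + n) * (modulus (coeff f k) * Num.sqrt k`!%:R).
Proof.
rewrite /hilbert_summand; move: (coeff f k) => c.
by rewrite !modulusM !modulus_ofR mulrA !ger0_norm ?sqrtr_ge0 ?moment_ge0.
Qed.

(** The factorial of the Fock norm cancels the factor [1 / sqrt (n!)] of the
    operator. *)
Lemma modulus_hilbert_coeff f n :
  modulus (hilbert_coeff mu f n) ^+ 2 * n`!%:R =
  modulus (limn (series (hilbert_summand mu f n))) ^+ 2.
Proof.
have f0 : 0 < n`!%:R :> R by rewrite ltr0n fact_gt0.
rewrite /hilbert_coeff modulusM modulusV modulus_ofR ger0_norm ?sqrtr_ge0 //.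
by rewrite exprMn exprVn sqr_sqrtr ?(ltW f0) // mulrC mulrA divff ?gt_eqF // mul1r.
Qed.

(** The Hankel estimate is transferred to the operator by letting the
    truncations of its coefficient series converge. *)
Lemma carleson_hilbert_bounded :
  carleson (1 + (beta - alpha) / 2) mu -> hilbert_bounded mu theta alpha beta.
Proof.
move=> hC; pose a := (1 + alpha) / 2; pose b := (1 + beta) / 2.
have ha : 0 < a < 1 by rewrite /a; case/andP: halpha => *; apply/andP; split; lra.
have hb : 0 < b < 1 by rewrite /b; case/andP: hbeta => *; apply/andP; split; lra.
have [C0 C00 hm] : exists2 C : R, 0 < C &
    forall n, moment mu n <= C * n.+1%:R `^ (- (1 + (beta - alpha) / 2)).
  apply: carleson_moment hC.
  by case/andP: halpha => *; case/andP: hbeta => *; apply/andP; split; lra.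
have [|K K0 hK] := schur a b C0 (moment mu) ha hb C00.
  move=> n; rewrite moment_ge0 /=.
  rewrite (_ : - (1 + b - a) = - (1 + (beta - alpha) / 2)); first exact: hm.
  by rewrite /a /b; field.
have alphaE : 2 * a - 1 = alpha by rewrite /a; field.
have betaE : 2 * b - 1 = beta by rewrite /b; field.
rewrite alphaE betaE in hK.
pose L := weight_const theta; have L0 : 0 < L by exact: weight_const_gt0.
have Q0 : 0 < L * (K * L) by rewrite !mulr_gt0.
exists (Num.sqrt (L * (K * L))); first by rewrite sqrtr_gt0.
move=> f ff; set S := fine (sq_fock_norm theta alpha f).
pose x k := modulus (coeff f k) * Num.sqrt k`!%:R.
have x0 k : 0 <= x k by rewrite mulr_ge0 ?modulus_ge0 ?sqrtr_ge0.
have hx N : \sum_(0 <= k < N) k.+1%:R `^ alpha * x k ^+ 2 <= L * S.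
  exact: weighted_sum_le.
have hN := hK x (L * S) x0 hx.
(* Keeping the single index [n] in the Schur estimate bounds the absolute
   series that defines the coefficient of order [n]. *)
have cvs n : cvgn (series (hilbert_summand mu f n)).
  pose q := (n.+1%:R : R) `^ beta.
  have q0 : 0 < q by rewrite powR_gt0.
  apply: (cvg_abs_series _ (K * (L * S) / q + 1)) => N.
  under eq_bigr do rewrite modulus_hilbert_summand.
  set Y := \sum_(_ <= _ < _) _.
  suff h : Y ^+ 2 <= K * (L * S) / q by have := sqr_ge0 (Y - 1); nra.
  rewrite ler_pdivlMr // mulrC; apply: le_trans (hN n.+1 N).
  rewrite big_nat_recr //= lerDr; apply: sumr_ge0 => i _.
  by rewrite mulr_ge0 ?powR_ge0 ?sqr_ge0.
have out N : \sum_(0 <= n < N) n.+1%:R `^ beta *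
    (modulus (hilbert_coeff mu f n) ^+ 2 * n`!%:R) <= K * (L * S).
  under eq_bigr do rewrite modulus_hilbert_coeff.
  have cw := cvg_weighted_sum (fun n => n.+1%:R `^ beta)
    (fun n => series (hilbert_summand mu f n))
    (fun n => limn (series (hilbert_summand mu f n))) N cvs.
  rewrite -(cvg_lim _ cw) //; apply: limr_le; first exact: (cvgP _ cw).
  near=> N'; apply: le_trans (hN N N'); apply: ler_sum => n _.
  apply: ler_wpM2l; first exact: powR_ge0.
  rewrite lerXn2r ?nnegrE ?modulus_ge0 //.
    by apply: sumr_ge0 => k _; rewrite mulr_ge0 ?moment_ge0.
  apply: (le_trans (modulus_sum _ _ _ _)); apply: ler_sum => k _.
  by rewrite modulus_hilbert_summand.
have rb : rapid (hilbert_coeff mu f).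
  apply: (rapid_of_fact _ (K * (L * S))) => n.
  have := out n.+1; rewrite big_nat_recr //= => h.
  have {}h : n.+1%:R `^ beta * (modulus (hilbert_coeff mu f n) ^+ 2 * n`!%:R)
      <= K * (L * S).
    apply: le_trans h; rewrite lerDr; apply: sumr_ge0 => i _.
    by rewrite !mulr_ge0 ?powR_ge0 ?modulus_ge0.
  have h1 : n.+1%:R `^ (-1) <= n.+1%:R `^ beta :> R.
    by rewrite ler_powR ?ler1n //; case/andP: hbeta' .
  rewrite powR_inv1 // in h1.
  rewrite -ler_pdivrMr // mulrC; apply: le_trans h; apply: ler_wpM2r => //.
  by rewrite mulr_ge0 // sqr_ge0.
have nb : (sq_fock_norm theta beta (hilbert_op mu f) <= (L * (K * L) * S)%:E)%E.
  apply: sq_fock_norm_le => N.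
  have -> : L * (K * L) * S = L * (K * (L * S)) by rewrite !mulrA.
  apply: (le_trans _ (ler_wpM2l (ltW L0) (out N))).
  rewrite mulr_sumr; apply: ler_sum => n _.
  rewrite coeff_psum // -[leLHS]mulrA [leRHS]mulrA; apply: ler_wpM2r.
    by rewrite mulr_ge0 // sqr_ge0.
  exact: (weight_cmp theta beta n htheta hbeta').1.
have fb : fock theta beta (hilbert_op mu f).
  by split; [exact: entire_psum|apply: le_lt_trans nb _; rewrite ltry].
split => //.
  split => // z; apply: cvgP; exact: cvg_psum.
rewrite /fock_norm -sqrtrM ?(ltW Q0) //; apply: ler_wsqrtr.
by rewrite -lee_fin sq_fock_norm_fineK.
Unshelve. all: by end_near. Qed.

Lemma big_block (V : nmodType) (g : nat -> V) N m : (N.*2 <= m)%N ->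
  \sum_(0 <= k < m) (if (N <= k < N.*2)%N then g k else 0) =
  \sum_(N <= k < N.*2) g k.
Proof.
move=> Nm; have NN : (N <= N.*2)%N by rewrite -addnn leq_addr.
rewrite (@big_cat_nat _ _ _ N) ?(leq_trans NN) //=.
rewrite [X in _ + X](@big_cat_nat _ _ _ N.*2) //=.
rewrite big_nat big1 ?add0r; last first.
  by move=> k /andP[_ kN]; rewrite leqNgt kN.
rewrite [X in _ + X]big_nat [X in _ + X]big1 ?addr0; last first.
  by move=> k /andP[kN _]; rewrite [(k < _)%N]ltnNge kN andbF.
by apply: eq_big_nat => k ->.
Qed.

(** Testing boundedness on the function whose normalised coefficients
    [a_k sqrt (k!)] are [1] for [N <= k < 2 N] and [0] elsewhere. *)
Lemma tail_le_of_bounded M (t : R) N : 0 < M -> (0 < N)%N -> 0 <= t < 1 ->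
  2^-1 <= t ^+ (4 * N) ->
  (forall f, fock theta alpha f ->
     fock theta beta (hilbert_op mu f) /\
     fock_norm theta beta (hilbert_op mu f) <= M * fock_norm theta alpha f) ->
  fine (mu `[t, 1[%classic) <=
    4 * weight_const theta * M * N%:R `^ (- (1 + (beta - alpha) / 2)).
Proof.
move=> M0 N0 ht t4 hM; have /andP[t0 t1] := ht.
set L := weight_const theta; have L0 : 0 < L by exact: weight_const_gt0.
have n0 : 0 < N%:R :> R by rewrite ltr0n.
have cstE (x : R) : N%:R * x = \sum_(N <= k < N.*2) x.
  by rewrite sumr_const_nat -addnn addnK mulr_natl.
pose c k : cplx R := if (N <= k < N.*2)%N then ofR (Num.sqrt k`!%:R)^-1 else 0.
have fk k : 0 < Num.sqrt k`!%:R :> R by rewrite sqrtr_gt0 ltr0n fact_gt0.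
have cE k : modulus (c k) ^+ 2 * k`!%:R = if (N <= k < N.*2)%N then 1 else 0.
  rewrite /c; case: ifP => _; last by rewrite modulus0 expr0n mul0r.
  rewrite modulus_ofR ger0_norm ?invr_ge0 ?(ltW (fk k)) // exprVn sqr_sqrtr //.
  by rewrite mulVf // pnatr_eq0 -lt0n fact_gt0.
have rc : rapid c.
  apply: (rapid_of_fact _ 1) => n; rewrite cE mul1r; case: ifP => _ //.
  by rewrite ler1n.
pose f := psum c.
have weight g k : -1 <= g <= 1 -> (N <= k < N.*2)%N ->
    k.+1%:R `^ g <= 2 * N%:R `^ g :> R /\ N%:R `^ g <= 2 * k.+1%:R `^ g :> R.
  move=> hg /andP[Nk kN].
  have e1 : k.+1%:R <= 2 * N%:R :> R by rewrite -natrM ler_nat mul2n.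
  have e2 : N%:R <= 2 * k.+1%:R :> R.
    by rewrite -natrM ler_nat mul2n -addnn (leq_trans Nk) // leqW // leq_addr.
  by split; apply: powR_dist.
have nf : (sq_fock_norm theta alpha f <= (2 * L * (N%:R * N%:R `^ alpha))%:E)%E.
  apply: sq_fock_norm_le => m.
  apply: (@le_trans _ _ (\sum_(0 <= k < N.*2 + m)
      (if (N <= k < N.*2)%N then (k%:R + theta) `^ alpha else 0))).
    rewrite [leRHS](@big_cat_nat _ _ _ m) ?leq_addl //=.
    rewrite -[leLHS]addr0; apply: lerD.
      apply: ler_sum => k _; rewrite coeff_psum // -mulrA cE.
      by case: ifP; rewrite ?mulr1 ?mulr0.
    by apply: sumr_ge0 => k _; case: ifP => // _; exact: powR_ge0.
  rewrite big_block ?leq_addr //.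
  apply: (@le_trans _ _ (\sum_(N <= k < N.*2) 2 * L * N%:R `^ alpha)).
    rewrite [leLHS]big_nat [leRHS]big_nat; apply: ler_sum => k hk.
    apply: (le_trans (weight_cmp theta alpha k htheta halpha').1).
    rewrite -/L [2 * L]mulrC -mulrA ler_wpM2l ?(ltW L0) //.
    by have [] := weight alpha k halpha' hk.
  by rewrite -cstE mulrCA.
have ff : fock theta alpha f.
  by split; [exact: entire_psum|apply: le_lt_trans nf _; rewrite ltry].
have [fb hle] := hM f ff.
pose Y n := \sum_(N <= k < N.*2) moment mu (k + n).
have Y0 n : 0 <= Y n by apply: sumr_ge0 => k _; exact: moment_ge0.
have limE n : limn (series (hilbert_summand mu f n)) = ofR (Y n).
  apply: cvg_lim => //; apply: cvg_near_cst; near=> m.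
  have Nm : (N.*2 <= m)%N by near: m; exact: nbhs_infty_ge.
  rewrite /Y [ofR _](rmorph_sum (real_complex R)) /= -(big_block _ _ _ m Nm).
  rewrite /series /=; apply: eq_bigr => k _.
  rewrite /hilbert_summand coeff_psum // /c; case: ifP => _; last first.
    by rewrite mulr0 mul0r.
  rewrite -mulrA -[ofR _^-1 * _](rmorphM (real_complex R)) /=.
  by rewrite mulVf ?gt_eqF // rmorph1 mulr1.
have bE n : modulus (hilbert_coeff mu f n) ^+ 2 * n`!%:R = Y n ^+ 2.
  by rewrite modulus_hilbert_coeff limE modulus_ofR ger0_norm.
have rb : rapid (hilbert_coeff mu f).
  pose m1 := fine (mu `[0, 1[%classic).
  have Ym n : Y n <= N%:R * m1.
    rewrite cstE; apply: ler_sum => k _.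
    exact: moment_le_mass.
  apply: (rapid_of_fact _ ((N%:R * m1) ^+ 2)) => n; rewrite bE.
  apply: (@le_trans _ _ ((N%:R * m1) ^+ 2)).
    by apply: lerXn2r; rewrite ?nnegrE // (le_trans (Y0 n)).
  by rewrite -[leLHS]mulr1 ler_wpM2l ?sqr_ge0 // ler1n.
set m0 := fine _.
have m00 : 0 <= m0 by exact: fine_ge0.
have Ylow n : (n < N.*2)%N -> N%:R * (m0 / 2) <= Y n.
  move=> nN; rewrite cstE.
  rewrite [leLHS]big_nat [leRHS]big_nat; apply: ler_sum => k /andP[_ kN].
  apply: le_trans (moment_ge_tail mu t (k + n) ht).
  rewrite mulrC ler_wpM2r //; apply: (le_trans t4).
  rewrite ler_wiXn2l ?(ltW t1) // -[(4 * N)%N]/(2 * 2 * N)%N -mulnA !mul2n -addnn.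
  by apply: leq_add; exact: ltnW.
have low : N%:R * (N%:R `^ beta / (2 * L) * (N%:R * (m0 / 2)) ^+ 2) <=
    fine (sq_fock_norm theta beta (hilbert_op mu f)).
  rewrite -lee_fin sq_fock_norm_fineK //.
  apply: le_trans (sq_fock_norm_ge theta beta _ N.*2); rewrite lee_fin.
  rewrite (@big_cat_nat _ _ _ N) //=; last by rewrite -addnn leq_addr.
  rewrite -[leLHS]add0r; apply: lerD.
    by apply: sumr_ge0 => n _; exact: sq_fock_term_ge0.
  rewrite cstE.
  rewrite [leLHS]big_nat [leRHS]big_nat; apply: ler_sum => n hn.
  rewrite coeff_psum // -[leRHS]mulrA bE; apply: ler_pM.
  - by rewrite divr_ge0 ?powR_ge0 // mulr_ge0 // ltW.
  - exact: sqr_ge0.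
  - rewrite ler_pdivrMr ?mulr_gt0 // mulrC -mulrA.
    have [_ h] := weight beta n hbeta' hn; apply: (le_trans h).
    by rewrite ler_wpM2l //; exact: (weight_cmp theta beta n htheta hbeta').2.
  - apply: lerXn2r; rewrite ?nnegrE ?Y0 //.
      by rewrite mulr_ge0 // divr_ge0.
    by case/andP: hn => _; exact: Ylow.
have up : fine (sq_fock_norm theta beta (hilbert_op mu f)) <=
    M ^+ 2 * (2 * L * (N%:R * N%:R `^ alpha)).
  have S0 : 0 <= fine (sq_fock_norm theta alpha f).
    by apply: fine_ge0; exact: sq_fock_norm_ge0.
  apply: (@le_trans _ _ (M ^+ 2 * fine (sq_fock_norm theta alpha f))).
    have F0 : 0 <= fine (sq_fock_norm theta beta (hilbert_op mu f)).
      by apply: fine_ge0; exact: sq_fock_norm_ge0.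
    rewrite -[leLHS](sqr_sqrtr F0) -[X in _ * X](sqr_sqrtr S0) -exprMn.
    by apply: lerXn2r; rewrite ?nnegrE ?sqrtr_ge0 // mulr_ge0 ?sqrtr_ge0 // ltW.
  by rewrite ler_wpM2l ?sqr_ge0 // -lee_fin sq_fock_norm_fineK.
(* [low] and [up] compare [N ^ (3 + beta) m0 ^ 2] with [N ^ (1 + alpha)]. *)
have lu := le_trans low up.
set s := 1 + (beta - alpha) / 2.
have R0 : 0 <= 4 * L * M * N%:R `^ (- s).
  by rewrite mulr_ge0 ?powR_ge0 // !mulr_ge0 // ltW.
rewrite -(@ler_pXn2r _ 2) ?nnegrE // exprMn -[X in _ * X]powR_mulrn ?powR_ge0 // -powRrM.
have -> : - s * 2%:R = alpha - beta - 2 by rewrite /s; field.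
have nN : N%:R != 0 :> R by rewrite gt_eqF.
have A0 : 0 < N%:R `^ beta :> R by rewrite powR_gt0.
have pw : N%:R `^ alpha = N%:R `^ (alpha - beta - 2) * (N%:R `^ beta * N%:R ^+ 2) :> R.
  rewrite -[N%:R ^+ 2]powR_mulrn // -!powRD ?nN ?implybT //.
  by congr (_ `^ _); ring.
rewrite pw in lu.
have Q0 : 0 < N%:R ^+ 3 * N%:R `^ beta / (8 * L) :> R.
  by rewrite divr_gt0 ?mulr_gt0 ?exprn_gt0.
rewrite -(ler_pM2l Q0).
have Ln0 : L != 0 by rewrite gt_eqF.
move: lu; congr (_ <= _); last by field.
by field.
Unshelve. all: by end_near. Qed.

(** Tails with [1 - t > 1 / 8] only need [mu] to be finite. *)
Lemma hilbert_bounded_carleson :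
  hilbert_bounded mu theta alpha beta -> carleson (1 + (beta - alpha) / 2) mu.
Proof.
move=> [M M0 hM]; set s := 1 + (beta - alpha) / 2.
have s0 : 0 < s.
  by rewrite /s; case/andP: halpha => *; case/andP: hbeta => *; lra.
have L0 : 0 < weight_const theta by exact: weight_const_gt0.
pose m1 := fine (mu `[0, 1[%classic).
have m10 : 0 <= m1 by exact: fine_ge0.
pose E := 4 * weight_const theta * M * 16 `^ s.
have E0 : 0 < E by rewrite !mulr_gt0 // powR_gt0.
exists (8 `^ s * m1 + E); first by rewrite ltr_wpDl // mulr_ge0 ?powR_ge0.
move=> t /andP[t0 t1]; rewrite -[leLHS]fineK; last first.
  exact: (tail_fin mu t).
rewrite lee_fin; set m0 := fine _; pose d := 1 - t.
have d0 : 0 < d by rewrite subr_gt0.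
rewrite -/d mulrDl.
have [dbig|dsmall] := ltP 8^-1 d.
  rewrite -[leLHS]addr0; apply: lerD; last by rewrite mulr_ge0 ?powR_ge0 // ltW.
  rewrite mulrAC -powRM // ?(ltW d0) //.
  have e1 : 1 <= 8 * d by rewrite -ler_pdivrMl // mulr1 ltW.
  have m01 : m0 <= m1.
    apply: fine_le; rewrite ?tail_fin //; apply: le_measure.
    - by rewrite inE; exact: measurable_itv.
    - by rewrite inE; exact: measurable_itv.
    - by move=> x /=; rewrite !in_itv /= => /andP[tx ->]; rewrite (le_trans t0 tx).
  rewrite -[leLHS]mul1r; apply: ler_pM => //; first exact: fine_ge0.
  have e2 : 1 `^ s = 1 :> R by rewrite powR1.
  rewrite -[leLHS]e2; apply: ge0_ler_powR; rewrite ?nnegrE ?(ltW s0) //.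
  by rewrite mulr_ge0 // ltW.
(* The block length is the integer part of [1 / (8 d)], so that
   [t ^ (4 N) >= 1 - 4 N d >= 1 / 2]. *)
pose N := Num.truncn ((8 * d)^-1).
have d80 : 0 < 8 * d by rewrite mulr_gt0.
have /andP[N1 N2] : N%:R <= (8 * d)^-1 < N.+1%:R.
  by apply: truncn_itv; rewrite invr_ge0 ltW.
have N0 : (0 < N)%N.
  by rewrite truncn_gt0 // invf_ge1 // mulrC -ler_pdivlMr // mul1r.
have n0 : 1 <= N%:R :> R by rewrite ler1n.
have {}N1 : N%:R * (8 * d) <= 1 by rewrite -ler_pdivlMr // mul1r.
have {}N2 : 1 < N.+1%:R * (8 * d) by rewrite -ltr_pdivrMr // mul1r.
have t4 : 2^-1 <= t ^+ (4 * N).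
  have bern k : 1 - k%:R * d <= t ^+ k.
    elim: k => [|k IH]; first by rewrite mul0r subr0 expr0.
    rewrite exprS; apply: (@le_trans _ _ (t * (1 - k%:R * d))); last exact: ler_wpM2l.
    have k0 : 0 <= k%:R :> R by [].
    have -> : t = 1 - d by rewrite /d subKr.
    by rewrite -natr1; have := sqr_ge0 d; nra.
  apply: le_trans (bern _); rewrite natrM; lra.
have := tail_le_of_bounded M t N M0 N0 _ t4.
rewrite t0 t1 => /(_ isT) /(_ _); rewrite -/s.
have fM f : fock theta alpha f -> fock theta beta (hilbert_op mu f) /\
    fock_norm theta beta (hilbert_op mu f) <= M * fock_norm theta alpha f.
  by move=> /hM[].
move=> /(_ fM) hb.
apply: (le_trans hb); apply: (@le_trans _ _ (E * d `^ s)); last first.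
  by rewrite lerDr !mulr_ge0 ?powR_ge0.
rewrite /E -[leRHS]mulrA ler_wpM2l //; first by rewrite !mulr_ge0 // ltW.
have -> : N%:R `^ (- s) = N%:R^-1 `^ s :> R.
  by rewrite -[N%:R^-1]powR_inv1 // -powRrM mulN1r.
rewrite -powRM // ?(ltW d0) //.
have Np : 0 < N%:R :> R by rewrite ltr0n.
apply: ge0_ler_powR; rewrite ?nnegrE ?(ltW s0) ?invr_ge0 //.
  by rewrite mulr_ge0 // ltW.
rewrite -[leLHS]mul1r ler_pdivrMr //; apply: (le_trans (ltW N2)).
by rewrite -natr1; nra.
Qed.

End Equivalence.

Theorem theorem1p6 (R : realType) (alpha beta theta : R)
    (mu : {finite_measure set (measurableTypeR R) -> \bar R})
    (halpha : -1 < alpha < 1) (hbeta : -1 < beta < 1) (htheta : 0 < theta)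
    (hmu : mu (~` `[0, 1[) = 0%E) :
  hilbert_bounded mu theta alpha beta <->
  carleson (1 + (beta - alpha) / 2) mu.
Proof.
split; first exact: hilbert_bounded_carleson.
exact: carleson_hilbert_bounded.
Qed.
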